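(* The Jacobson radical of Novikov algebras is hereditary: for every Novikov algebra $A$ over $F$ and every two-sided ideal $I$ of $A$, $$\mathcal J(I)=\mathcal J(A)\cap I.$$
   Context: $F$ is a field of characteristic different from $2$; all algebras are (not necessarily associative or unital) algebras over $F$. Write $(x,y,z)=(xy)z-x(yz)$. An algebra is a Novikov algebra if it satisfies the identities $(x,y,z)=(y,x,z)$ and $(xy)z=(xz)y$. Right modules. Let $\mathcal N_X$ be the free Novikov algebra over $F$ on countably many generators $X=\{x_1,x_2,\dots\}$. For a vector space $V$ let $T(V)$ be its tensor algebra; a linear map $\varphi:V\to B$ to a unital associative algebra $B$ induces the homomorphism $T(\varphi):T(V)\to B$, $1\mapsto 1$, $v_1\otimes\dots\otimes v_n\mapsto\varphi(v_1)\cdots\varphi(v_n)$. Endomorphisms act on the right: $m(\alpha\beta)=(m\alpha)\beta$. Let $R:\mathcal N_X\to\mathrm{End}(\mathcal N_X)$, $R(f)=R_f$, $gR_f=gf$. Elements of the kernel of $T(R):T(\mathcal N_X)\to\mathrm{End}(\mathcal N_X)$ are called R-identities. For $G(x_1,\dots,x_n)\in T(\mathcal N_X)$ and $a_1,\dots,a_n$ in a Novikov algebra $A$, $G(a_1,\dots,a_n)\in T(A)$ is obtained by substituting $a_i$ for $x_i$. A right (Novikov) representation of $A$ is a linear map $\rho:A\to\mathrm{End}(M)$, $M$ a vector space, such that $T(\rho)(G(a_1,\dots,a_n))=0$ for every R-identity $G$ and all $a_i\in A$. The space $M$ with the action $m\cdot a=m\rho(a)$ is then called a right (Novikov) $A$-module.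 A right $A$-module $M$ is irreducible if it has no nonzero proper submodules and $MA\neq 0$. Jacobson radical. $\mathcal J$ denotes the class of Novikov algebras over $F$ that have no irreducible right Novikov modules. This class is radical (in the Kurosh–Amitsur sense); in particular every Novikov algebra $A$ has a largest two-sided ideal $\mathcal J(A)$ which, as an algebra, belongs to $\mathcal J$. The ideal $\mathcal J(A)$ is called the Jacobson radical of $A$. *)

(* Defs.v *)
From HB Require Import structures.
From mathcomp Require Import all_boot all_order all_algebra.
From mathcomp Require Import boolp classical_sets.

Set Implicit Arguments.
Unset Strict Implicit.
Unset Printing Implicit Defensive.

Import GRing.Theory.
Local Open Scope ring_scope.
Local Open Scope classical_set_scope.
Local Open Scope quotient_scope.

(* No associativity, unit or commutativity is assumed in [nalgType].     *)

HB.mixin Record Lmodule_isNAlg (F : fieldType) A of GRing.Lmodule F A := {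
  nmul : A -> A -> A;
  nmulDl : forall x y z : A, nmul (x + y) z = nmul x z + nmul y z;
  nmulDr : forall x y z : A, nmul x (y + z) = nmul x y + nmul x z;
  nmulZl : forall (a : F) (x y : A), nmul (a *: x) y = a *: nmul x y;
  nmulZr : forall (a : F) (x y : A), nmul x (a *: y) = a *: nmul x y;
}.

#[short(type="nalgType")]
HB.structure Definition NAlg (F : fieldType) :=
  {A of GRing.Lmodule F A & Lmodule_isNAlg F A}.

Definition nassoc (F : fieldType) (A : nalgType F) (x y z : A) : A :=
  nmul (nmul x y) z - nmul x (nmul y z).

HB.mixin Record NAlg_isNovikov (F : fieldType) A of NAlg F A := {
  nov_lsym : forall x y z : A, nassoc x y z = nassoc y x z;
  nov_rcomm : forall x y z : A, nmul (nmul x y) z = nmul (nmul x z) y;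
}.

#[short(type="novikovType")]
HB.structure Definition Novikov (F : fieldType) :=
  {A of NAlg F A & NAlg_isNovikov F A}.

(* Unital associative algebras.  The library's [algType] excludes the    *)
(* zero ring, hence the endomorphisms of the zero space.                 *)

HB.mixin Record NAlg_isUAlg (F : fieldType) B of NAlg F B := {
  uone : B;
  nmulA : forall x y z : B, nmul x (nmul y z) = nmul (nmul x y) z;
  nmul1l : forall x : B, nmul uone x = x;
  nmul1r : forall x : B, nmul x uone = x;
}.

#[short(type="ualgType")]
HB.structure Definition UAlg (F : fieldType) :=
  {B of NAlg F B & NAlg_isUAlg F B}.

(* Algebras given by generators and relations: classes of formal         *)
(* expressions.  Used for both the free Novikov algebra and the tensor   *)
(* algebra.                                                              *)

Inductive term (F G : Type) : Type :=
| tgen of G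
| tzero
| tadd of term F G & term F G
| topp of term F G
| tscale of F & term F G
| tmul of term F G & term F G.
Arguments tgen {F G}.
Arguments tzero {F G}.

HB.instance Definition _ (F G : Type) := gen_eqMixin (term F G).
HB.instance Definition _ (F G : Type) := gen_choiceMixin (term F G).

Section Presentation.
Variables (F : fieldType) (G : Type) (rel : term F G -> term F G -> Prop).
Local Notation term := (term F G).

(* The least congruence containing [rel] whose quotient is an algebra. *)
Inductive cong : term -> term -> Prop :=
| cong_rel s t : rel s t -> cong s t
| cong_refl s : cong s s
| cong_sym s t : cong s t -> cong t s
| cong_trans s t u : cong s t -> cong t u -> cong s u
| cong_add s s' t t' : cong s s' -> cong t t' -> cong (tadd s t) (tadd s' t')
| cong_opp s s' : cong s s' -> cong (topp s) (topp s')
| cong_scale a s s' : cong s s' -> cong (tscale a s) (tscale a s')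
| cong_mul s s' t t' : cong s s' -> cong t t' -> cong (tmul s t) (tmul s' t')
| cong_addA s t u : cong (tadd s (tadd t u)) (tadd (tadd s t) u)
| cong_addC s t : cong (tadd s t) (tadd t s)
| cong_add0 s : cong (tadd tzero s) s
| cong_addN s : cong (tadd (topp s) s) tzero
| cong_scaleA a b s : cong (tscale a (tscale b s)) (tscale (a * b) s)
| cong_scale1 s : cong (tscale 1 s) s
| cong_scaleDr a s t :
    cong (tscale a (tadd s t)) (tadd (tscale a s) (tscale a t))
| cong_scaleDl a b s :
    cong (tscale (a + b) s) (tadd (tscale a s) (tscale b s))
| cong_mulDl s t u : cong (tmul (tadd s t) u) (tadd (tmul s u) (tmul t u))
| cong_mulDr s t u : cong (tmul s (tadd t u)) (tadd (tmul s t) (tmul s u))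
| cong_mulZl a s t : cong (tmul (tscale a s) t) (tscale a (tmul s t))
| cong_mulZr a s t : cong (tmul s (tscale a t)) (tscale a (tmul s t)).

Definition congb (s t : term) : bool := `[< cong s t >].

Lemma congb_equiv : equiv_class_of congb.
Proof.
split=> [s|s t|t s u].
- exact/asboolP/cong_refl.
- by apply/asboolP/asboolP; apply: cong_sym.
- by move=> /asboolP st /asboolP tu; apply/asboolP; apply: cong_trans st tu.
Qed.
Canonical congb_equivRel := EquivRelPack congb_equiv.

Definition pres : Type := {eq_quot congb}.
HB.instance Definition _ := Choice.on pres.
HB.instance Definition _ := EqQuotient.on pres.

Definition pcls (t : term) : pres := \pi_pres t.
Definition pgen (g : G) : pres := pcls (tgen g).

Lemma pclsP s t : pcls s = pcls t <-> cong s t.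
Proof. by split=> [/eqquotP/asboolP|h] //; apply/eqquotP/asboolP. Qed.

Lemma pcls_repr t : cong (repr (pcls t)) t.
Proof. by apply/pclsP; rewrite /pcls reprK. Qed.

Lemma pres_ind (P : pres -> Prop) : (forall t, P (pcls t)) -> forall x, P x.
Proof. by move=> h x; rewrite -[x]reprK; apply: h. Qed.

Definition padd (x y : pres) := pcls (tadd (repr x) (repr y)).
Definition popp (x : pres) := pcls (topp (repr x)).
Definition pscale (a : F) (x : pres) := pcls (tscale a (repr x)).
Definition pmul (x y : pres) := pcls (tmul (repr x) (repr y)).

Lemma pclsD s t : padd (pcls s) (pcls t) = pcls (tadd s t).
Proof. by apply/pclsP/cong_add; apply: pcls_repr. Qed.
Lemma pclsN s : popp (pcls s) = pcls (topp s).
Proof. by apply/pclsP/cong_opp; apply: pcls_repr. Qed.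
Lemma pclsZ a s : pscale a (pcls s) = pcls (tscale a s).
Proof. by apply/pclsP/cong_scale; apply: pcls_repr. Qed.
Lemma pclsM s t : pmul (pcls s) (pcls t) = pcls (tmul s t).
Proof. by apply/pclsP/cong_mul; apply: pcls_repr. Qed.

Definition pclsE := (pclsD, pclsN, pclsZ, pclsM).

Lemma paddA : associative padd.
Proof.
elim/pres_ind=> s; elim/pres_ind=> t; elim/pres_ind=> u; rewrite !pclsE.
exact/pclsP/cong_addA.
Qed.
Lemma paddC : commutative padd.
Proof.
by elim/pres_ind=> s; elim/pres_ind=> t; rewrite !pclsE; apply/pclsP/cong_addC.
Qed.
Lemma padd0 : left_id (pcls tzero) padd.
Proof. by elim/pres_ind=> s; rewrite !pclsE; apply/pclsP/cong_add0. Qed.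
Lemma paddN : left_inverse (pcls tzero) popp padd.
Proof. by elim/pres_ind=> s; rewrite !pclsE; apply/pclsP/cong_addN. Qed.

HB.instance Definition _ := GRing.isZmodule.Build pres paddA paddC padd0 paddN.

Lemma pscaleA a b x : pscale a (pscale b x) = pscale (a * b) x.
Proof. by elim/pres_ind: x => s; rewrite !pclsE; apply/pclsP/cong_scaleA. Qed.
Lemma pscale1 : left_id 1 pscale.
Proof. by elim/pres_ind=> s; rewrite !pclsE; apply/pclsP/cong_scale1. Qed.
Lemma pscaleDr : right_distributive pscale +%R.
Proof.
move=> a; elim/pres_ind=> s; elim/pres_ind=> t; rewrite /GRing.add /= !pclsE.
exact/pclsP/cong_scaleDr.
Qed.
Lemma pscaleDl x : {morph pscale^~ x : a b / a + b}.
Proof.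
elim/pres_ind: x => s a b; rewrite /GRing.add /= !pclsE.
exact/pclsP/cong_scaleDl.
Qed.

HB.instance Definition _ := GRing.Zmodule_isLmodule.Build F pres
  pscaleA pscale1 pscaleDr pscaleDl.

Lemma pclsDE s t : pcls (tadd s t) = pcls s + pcls t.
Proof. by rewrite -pclsD. Qed.
Lemma pclsZE a s : pcls (tscale a s) = a *: pcls s.
Proof. by rewrite -pclsZ. Qed.

Lemma pmulDl x y z : pmul (x + y) z = pmul x z + pmul y z.
Proof.
elim/pres_ind: x => s; elim/pres_ind: y => t; elim/pres_ind: z => u.
by rewrite -pclsDE !pclsM -pclsDE; apply/pclsP/cong_mulDl.
Qed.
Lemma pmulDr x y z : pmul x (y + z) = pmul x y + pmul x z.
Proof.
elim/pres_ind: x => s; elim/pres_ind: y => t; elim/pres_ind: z => u.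
by rewrite -pclsDE !pclsM -pclsDE; apply/pclsP/cong_mulDr.
Qed.
Lemma pmulZl a x y : pmul (a *: x) y = a *: pmul x y.
Proof.
elim/pres_ind: x => s; elim/pres_ind: y => t.
by rewrite -pclsZE !pclsM -pclsZE; apply/pclsP/cong_mulZl.
Qed.
Lemma pmulZr a x y : pmul x (a *: y) = a *: pmul x y.
Proof.
elim/pres_ind: x => s; elim/pres_ind: y => t.
by rewrite -pclsZE !pclsM -pclsZE; apply/pclsP/cong_mulZr.
Qed.

HB.instance Definition _ := Lmodule_isNAlg.Build F pres
  pmulDl pmulDr pmulZl pmulZr.

Lemma pclsME s t : pcls (tmul s t) = nmul (pcls s) (pcls t).
Proof. by rewrite -pclsM. Qed.
Lemma pcls0E : pcls tzero = 0. Proof. by []. Qed.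
Lemma pclsNE s : pcls (topp s) = - pcls s.
Proof. by rewrite -pclsN. Qed.

Section Eval.
Variables (B : nalgType F) (f : G -> B).

Fixpoint teval (t : term) : B :=
  match t with
  | tgen g => f g
  | tzero => 0
  | tadd s t => teval s + teval t
  | topp s => - teval s
  | tscale a s => a *: teval s
  | tmul s t => nmul (teval s) (teval t)
  end.

Definition peval (x : pres) : B := teval (repr x).

Hypothesis f_rel : forall s t, rel s t -> teval s = teval t.

Lemma teval_cong s t : cong s t -> teval s = teval t.
Proof.
elim=> {s t} //=.
- by move=> s t u _ -> _ ->.
- by move=> s s' t t' _ -> _ ->.
- by move=> s s' _ ->.
- by move=> a s s' _ ->.
- by move=> s s' t t' _ -> _ ->.
- by move=> s t u; rewrite addrA.
- by move=> s t; rewrite addrC.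
- by move=> s; rewrite add0r.
- by move=> s; rewrite addNr.
- by move=> a b s; rewrite scalerA.
- by move=> s; rewrite scale1r.
- by move=> a s t; rewrite scalerDr.
- by move=> a b s; rewrite scalerDl.
- by move=> s t u; rewrite nmulDl.
- by move=> s t u; rewrite nmulDr.
- by move=> a s t; rewrite nmulZl.
- by move=> a s t; rewrite nmulZr.
Qed.

Lemma peval_cls t : peval (pcls t) = teval t.
Proof. exact/teval_cong/pcls_repr. Qed.

Lemma peval_gen g : peval (pgen g) = f g.
Proof. exact: peval_cls. Qed.

Lemma peval_linear : linear peval.
Proof.
move=> a; elim/pres_ind=> s; elim/pres_ind=> t.
by rewrite -pclsZE -pclsDE !peval_cls.
Qed.

Lemma pevalM x y : peval (nmul x y) = nmul (peval x) (peval y).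
Proof.
by elim/pres_ind: x => s; elim/pres_ind: y => t; rewrite -pclsME !peval_cls.
Qed.

Lemma peval_unique (h : pres -> B) : linear h ->
  (forall x y, h (nmul x y) = nmul (h x) (h y)) ->
  (forall g, h (pgen g) = f g) -> h =1 peval.
Proof.
move=> hlin hM hg; elim/pres_ind=> t; rewrite peval_cls.
have h0 : h 0 = 0.
  by have := hlin (-1) 0 0; rewrite scaler0 addr0 scaleN1r addNr.
have hD x y : h (x + y) = h x + h y.
  by have := hlin 1 x y; rewrite !scale1r.
have hZ a x : h (a *: x) = a *: h x.
  by have := hlin a x 0; rewrite !addr0 h0 addr0.
elim: t => [g||s IHs t IHt|s IHs|a s IHs|s IHs t IHt] /=.
- exact: hg.
- exact: h0.
- by rewrite pclsDE hD IHs IHt.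
- by rewrite pclsNE -scaleN1r hZ IHs scaleN1r.
- by rewrite pclsZE hZ IHs.
- by rewrite pclsME hM IHs IHt.
Qed.

End Eval.
End Presentation.

Section FreeNovikov.
Variable F : fieldType.

Definition tassoc (G : Type) (s t u : term F G) : term F G :=
  tadd (tmul (tmul s t) u) (topp (tmul s (tmul t u))).

Inductive nov_rel : term F nat -> term F nat -> Prop :=
| nov_rel_lsym s t u : nov_rel (tassoc s t u) (tassoc t s u)
| nov_rel_rcomm s t u : nov_rel (tmul (tmul s t) u) (tmul (tmul s u) t).

(* The generators are [fvar F 0], [fvar F 1], etc. *)
Definition freeNov : Type := pres nov_rel.
HB.instance Definition _ := NAlg.on freeNov.

Lemma freeNov_lsym (x y z : freeNov) : nassoc x y z = nassoc y x z.
Proof.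
rewrite /nassoc.
elim/pres_ind: x => s; elim/pres_ind: y => t; elim/pres_ind: z => u.
have: pcls nov_rel (tassoc s t u) = pcls nov_rel (tassoc t s u).
  exact/pclsP/cong_rel/nov_rel_lsym.
by rewrite !pclsDE !pclsNE !pclsME.
Qed.
Lemma freeNov_rcomm (x y z : freeNov) :
  nmul (nmul x y) z = nmul (nmul x z) y.
Proof.
elim/pres_ind: x => s; elim/pres_ind: y => t; elim/pres_ind: z => u.
have: pcls nov_rel (tmul (tmul s t) u) = pcls nov_rel (tmul (tmul s u) t).
  exact/pclsP/cong_rel/nov_rel_rcomm.
by rewrite !pclsME.
Qed.
HB.instance Definition _ :=
  NAlg_isNovikov.Build F freeNov freeNov_lsym freeNov_rcomm.

Definition fvar (i : nat) : freeNov := pgen nov_rel i.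

Variables (A : novikovType F) (a : nat -> A).

Definition fsubst : freeNov -> A := @peval F nat nov_rel A a.

Lemma fsubst_rel s t : nov_rel s t -> teval a s = teval a t.
Proof. by case=> {}s {}t u /=; [exact: nov_lsym|exact: nov_rcomm]. Qed.

Lemma fsubst_linear : linear fsubst.
Proof. exact: (peval_linear fsubst_rel). Qed.
HB.instance Definition _ :=
  GRing.isLinear.Build F freeNov A _ fsubst fsubst_linear.

Lemma fsubst_var i : fsubst (fvar i) = a i.
Proof. exact: (peval_gen fsubst_rel). Qed.

Lemma fsubstM x y : fsubst (nmul x y) = nmul (fsubst x) (fsubst y).
Proof. exact: (pevalM fsubst_rel). Qed.

Lemma fsubst_unique (h : {linear freeNov -> A}) :
  (forall x y, h (nmul x y) = nmul (h x) (h y)) ->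
  (forall i, h (fvar i) = a i) -> h =1 fsubst.
Proof. by apply: (peval_unique fsubst_rel); apply: linearP. Qed.

End FreeNovikov.
Arguments fsubst {F A} a.
Arguments fvar F i : clear implicits.

(* The tensor algebra of V, presented as the unital associative algebra  *)
(* generated by V subject to the linear relations holding in V; the      *)
(* generator [None] is the unit.                                         *)

Section TensorAlgebra.
Variables (F : fieldType) (V : lmodType F).
Local Notation tone := (@tgen F (option V) None).

Inductive tens_rel : term F (option V) -> term F (option V) -> Prop :=
| tens_rel_add u v : tens_rel (tgen (Some (u + v)))
    (tadd (tgen (Some u)) (tgen (Some v)))
| tens_rel_scale c v :
    tens_rel (tgen (Some (c *: v))) (tscale c (tgen (Some v)))
| tens_rel_mulA s t u : tens_rel (tmul s (tmul t u)) (tmul (tmul s t) u)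
| tens_rel_mul1l s : tens_rel (tmul tone s) s
| tens_rel_mul1r s : tens_rel (tmul s tone) s.

Definition tensor_algebra : Type := pres tens_rel.
HB.instance Definition _ := NAlg.on tensor_algebra.

Definition ta_one : tensor_algebra := pgen tens_rel None.

Lemma ta_mulA (x y z : tensor_algebra) :
  nmul x (nmul y z) = nmul (nmul x y) z.
Proof.
elim/pres_ind: x => s; elim/pres_ind: y => t; elim/pres_ind: z => u.
have: pcls tens_rel (tmul s (tmul t u)) = pcls tens_rel (tmul (tmul s t) u).
  exact/pclsP/cong_rel/tens_rel_mulA.
by rewrite !pclsME.
Qed.
Lemma ta_mul1l (x : tensor_algebra) : nmul ta_one x = x.
Proof.
elim/pres_ind: x => s.
have: pcls tens_rel (tmul tone s) = pcls tens_rel s.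
  exact/pclsP/cong_rel/tens_rel_mul1l.
by rewrite pclsME.
Qed.
Lemma ta_mul1r (x : tensor_algebra) : nmul x ta_one = x.
Proof.
elim/pres_ind: x => s.
have: pcls tens_rel (tmul s tone) = pcls tens_rel s.
  exact/pclsP/cong_rel/tens_rel_mul1r.
by rewrite pclsME.
Qed.
HB.instance Definition _ := NAlg_isUAlg.Build F tensor_algebra
  ta_mulA ta_mul1l ta_mul1r.

Definition tensor_in (v : V) : tensor_algebra := pgen tens_rel (Some v).

Lemma tensor_in_linear : linear tensor_in.
Proof.
move=> c u v; rewrite /tensor_in /pgen -pclsZE -pclsDE; apply/pclsP.
apply: cong_trans (cong_rel (tens_rel_add _ _)) _.
apply: cong_add (cong_refl _ _); exact/cong_rel/tens_rel_scale.
Qed.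
HB.instance Definition _ :=
  GRing.isLinear.Build F V tensor_algebra _ tensor_in tensor_in_linear.

Variables (B : ualgType F) (phi : {linear V -> B}).

Definition tensor_gen (v : option V) : B := oapp phi (uone : B) v.

Lemma tensor_gen_rel s t :
  tens_rel s t -> teval tensor_gen s = teval tensor_gen t.
Proof.
case=> {s t} [u v|c v|s t u|s|s] /=.
- exact: linearD.
- exact: linearZ.
- exact: nmulA.
- exact: nmul1l.
- exact: nmul1r.
Qed.

(* T(phi) *)
Definition tensor_lift : tensor_algebra -> B := peval tensor_gen.

Lemma tensor_lift_linear : linear tensor_lift.
Proof. exact: (peval_linear tensor_gen_rel). Qed.
HB.instance Definition _ := GRing.isLinear.Build F tensor_algebra B _
  tensor_lift tensor_lift_linear.

Lemma tensor_lift1 : tensor_lift uone = uone.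
Proof. exact: (peval_gen tensor_gen_rel). Qed.

Lemma tensor_liftM x y :
  tensor_lift (nmul x y) = nmul (tensor_lift x) (tensor_lift y).
Proof. exact: (pevalM tensor_gen_rel). Qed.

Lemma tensor_liftE v : tensor_lift (tensor_in v) = phi v.
Proof. exact: (peval_gen tensor_gen_rel). Qed.

Lemma tensor_lift_unique (h : {linear tensor_algebra -> B}) :
  h uone = uone -> (forall x y, h (nmul x y) = nmul (h x) (h y)) ->
  (forall v, h (tensor_in v) = phi v) -> h =1 tensor_lift.
Proof.
move=> h1 hM hv; apply: (peval_unique tensor_gen_rel _ hM); first exact: linearP.
by case=> [v|] /=; [exact: hv|exact: h1].
Qed.

End TensorAlgebra.
Arguments tensor_in {F V}.

Definition tensor_map (F : fieldType) (V W : lmodType F)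
    (f : {linear V -> W}) : tensor_algebra V -> tensor_algebra W :=
  tensor_lift (tensor_in \o f).

(* Endomorphisms act on the right: [nmul f g] applies [f] first.         *)

Section Endomorphisms.
Variables (F : fieldType) (M : lmodType F).

Definition endo : Type := {linear M -> M}.
Definition act (m : M) (f : endo) : M := (f : {linear M -> M}) m.

HB.instance Definition _ := gen_eqMixin endo.
HB.instance Definition _ := gen_choiceMixin endo.

Lemma endoP (f g : endo) : (forall m, act m f = act m g) -> f = g.
Proof.
case: f g => [f [[pf1] [pf2]]] [g [[pg1] [pg2]]].
rewrite /act /= => /funext fg; move: pf1 pf2 pg1 pg2.
by rewrite fg => *; do !f_equal; apply: Prop_irrelevance.
Qed.

Definition endo0 : endo := \0.
Definition endo_add (f g : endo) : endo :=
  (f : {linear M -> M}) \+ (g : {linear M -> M}).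
Definition endo_opp (f : endo) : endo := \- (f : {linear M -> M}).
Definition endo_scale (a : F) (f : endo) : endo := a \*: (f : {linear M -> M}).
Definition endo1 : endo := idfun.
Definition endo_mul (f g : endo) : endo :=
  (g : {linear M -> M}) \o (f : {linear M -> M}).

Lemma endo_addA : associative endo_add.
Proof. by move=> f g h; apply: endoP => m; apply: addrA. Qed.
Lemma endo_addC : commutative endo_add.
Proof. by move=> f g; apply: endoP => m; apply: addrC. Qed.
Lemma endo_add0 : left_id endo0 endo_add.
Proof. by move=> f; apply: endoP => m; apply: add0r. Qed.
Lemma endo_addN : left_inverse endo0 endo_opp endo_add.
Proof. by move=> f; apply: endoP => m; apply: addNr. Qed.
HB.instance Definition _ :=
  GRing.isZmodule.Build endo endo_addA endo_addC endo_add0 endo_addN.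

Lemma endo_scaleA a b f : endo_scale a (endo_scale b f) = endo_scale (a * b) f.
Proof. by apply: endoP => m; apply: scalerA. Qed.
Lemma endo_scale1 : left_id 1 endo_scale.
Proof. by move=> f; apply: endoP => m; apply: scale1r. Qed.
Lemma endo_scaleDr : right_distributive endo_scale +%R.
Proof. by move=> a f g; apply: endoP => m; apply: scalerDr. Qed.
Lemma endo_scaleDl f : {morph endo_scale^~ f : a b / a + b}.
Proof. by move=> a b; apply: endoP => m; apply: scalerDl. Qed.
HB.instance Definition _ := GRing.Zmodule_isLmodule.Build F endo
  endo_scaleA endo_scale1 endo_scaleDr endo_scaleDl.

Lemma endo_mulDl f g h : endo_mul (f + g) h = endo_mul f h + endo_mul g h.
Proof. by apply: endoP => m; apply: (linearD (h : {linear M -> M})). Qed.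
Lemma endo_mulDr f g h : endo_mul f (g + h) = endo_mul f g + endo_mul f h.
Proof. exact: endoP. Qed.
Lemma endo_mulZl (a : F) f g : endo_mul (a *: f) g = a *: endo_mul f g.
Proof. by apply: endoP => m; apply: (linearZZ (g : {linear M -> M})). Qed.
Lemma endo_mulZr (a : F) f g : endo_mul f (a *: g) = a *: endo_mul f g.
Proof. exact: endoP. Qed.
HB.instance Definition _ := Lmodule_isNAlg.Build F endo
  endo_mulDl endo_mulDr endo_mulZl endo_mulZr.

Lemma endo_mulA (f g h : endo) : nmul f (nmul g h) = nmul (nmul f g) h.
Proof. exact: endoP. Qed.
Lemma endo_mul1l (f : endo) : nmul endo1 f = f. Proof. exact: endoP. Qed.
Lemma endo_mul1r (f : endo) : nmul f endo1 = f. Proof. exact: endoP. Qed.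
HB.instance Definition _ :=
  NAlg_isUAlg.Build F endo endo_mulA endo_mul1l endo_mul1r.

Lemma actM (m : M) (f g : endo) : act m (nmul f g) = act (act m f) g.
Proof. by []. Qed.

End Endomorphisms.

Section RightMultiplication.
Variables (F : fieldType) (A : nalgType F).

Definition rmul_fun (f g : A) : A := nmul g f.
Lemma rmul_fun_linear f : linear (rmul_fun f).
Proof. by move=> a g h; rewrite /rmul_fun nmulDl nmulZl. Qed.
HB.instance Definition _ f :=
  GRing.isLinear.Build F A A _ (rmul_fun f) (rmul_fun_linear f).

Definition rmul (f : A) : endo A := rmul_fun f.
Lemma rmul_linear : linear rmul.
Proof.
move=> a f g; apply: endoP => h.
by rewrite /act /= /rmul_fun nmulDr nmulZr.
Qed.
HB.instance Definition _ := GRing.isLinear.Build F A (endo A) _ rmul rmul_linear.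

Lemma rmulE (f g : A) : act g (rmul f) = nmul g f. Proof. by []. Qed.

End RightMultiplication.
Arguments rmul {F} A.

Definition R_identity (F : fieldType) (G : tensor_algebra (freeNov F)) : Prop :=
  tensor_lift (rmul (freeNov F)) G = 0.

(* An R-identity involves finitely many variables only, so that it makes *)
(* no difference to substitute for all the variables at once.            *)
Definition right_rep (F : fieldType) (A : novikovType F) (M : lmodType F)
    (rho : {linear A -> endo M}) : Prop :=
  forall G, R_identity G ->
  forall a : nat -> A, tensor_lift rho (tensor_map (fsubst a) G) = 0.

Section Modules.
Variables (F : fieldType) (A : novikovType F) (M : lmodType F).
Variable rho : {linear A -> endo M}.

Definition submodule (N : set M) : Prop :=
  [/\ N 0, forall (c : F) m n, N m -> N n -> N (c *: m + n)
    & forall m a, N m -> N (act m (rho a))].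

Definition irreducible_rep : Prop :=
  (forall N : set M, submodule N -> N = [set 0] \/ N = setT) /\
  (exists m a, act m (rho a) != 0).

End Modules.

Definition in_J (F : fieldType) (A : novikovType F) : Prop :=
  ~ exists (M : lmodType F) (rho : {linear A -> endo M}),
      right_rep rho /\ irreducible_rep rho.

Record ideal (F : fieldType) (A : novikovType F) := Ideal {
  ideal_set :> set A;
  ideal0 : ideal_set 0;
  idealP : forall (c : F) x y, ideal_set x -> ideal_set y ->
             ideal_set (c *: x + y);
  idealMl : forall x y, ideal_set y -> ideal_set (nmul x y);
  idealMr : forall x y, ideal_set x -> ideal_set (nmul x y);
}.

Section IdealAlgebra.
Variables (F : fieldType) (A : novikovType F) (I : ideal A).

Definition ideal_pred : pred A := fun x => x \in (I : set A).

Lemma ideal_predP x : reflect (ideal_set I x) (x \in ideal_pred).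
Proof. by apply: (iffP idP) => [/set_mem|/mem_set]. Qed.

Lemma ideal_submod : submod_closed ideal_pred.
Proof.
split=> [|c x y /ideal_predP Ix /ideal_predP Iy]; apply/ideal_predP.
  exact: ideal0.
exact: idealP.
Qed.
HB.instance Definition _ :=
  GRing.isSubmodClosed.Build F A ideal_pred ideal_submod.

Definition ideal_alg : Type := {x : A | x \in ideal_pred}.
HB.instance Definition _ := Choice.on ideal_alg.
HB.instance Definition _ := SubType.on ideal_alg.
HB.instance Definition _ := [SubChoice_isSubLmodule of ideal_alg by <:].

Lemma ideal_algMP (x y : ideal_alg) : nmul (val x) (val y) \in ideal_pred.
Proof. by apply/ideal_predP/idealMl/ideal_predP/valP. Qed.
Definition ideal_mul (x y : ideal_alg) : ideal_alg :=
  exist _ (nmul (val x) (val y)) (ideal_algMP x y).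

Lemma ideal_mulDl x y z : ideal_mul (x + y) z = ideal_mul x z + ideal_mul y z.
Proof. by apply: val_inj; apply: nmulDl. Qed.
Lemma ideal_mulDr x y z : ideal_mul x (y + z) = ideal_mul x y + ideal_mul x z.
Proof. by apply: val_inj; apply: nmulDr. Qed.
Lemma ideal_mulZl (c : F) x y : ideal_mul (c *: x) y = c *: ideal_mul x y.
Proof. by apply: val_inj; apply: nmulZl. Qed.
Lemma ideal_mulZr (c : F) x y : ideal_mul x (c *: y) = c *: ideal_mul x y.
Proof. by apply: val_inj; apply: nmulZr. Qed.
HB.instance Definition _ := Lmodule_isNAlg.Build F ideal_alg
  ideal_mulDl ideal_mulDr ideal_mulZl ideal_mulZr.

Lemma ideal_lsym (x y z : ideal_alg) : nassoc x y z = nassoc y x z.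
Proof. by apply: val_inj; apply: nov_lsym. Qed.
Lemma ideal_rcomm (x y z : ideal_alg) : nmul (nmul x y) z = nmul (nmul x z) y.
Proof. by apply: val_inj; apply: nov_rcomm. Qed.
HB.instance Definition _ :=
  NAlg_isNovikov.Build F ideal_alg ideal_lsym ideal_rcomm.

End IdealAlgebra.

Definition largest_J_ideal (F : fieldType) (A : novikovType F) (J : set A) :
    Prop :=
  exists2 K : ideal A, J = K &
    in_J (ideal_alg K) /\
    (forall L : ideal A, in_J (ideal_alg L) -> L `<=` K).

Lemma largest_J_ideal_unique (F : fieldType) (A : novikovType F) (J K : set A) :
  largest_J_ideal J -> largest_J_ideal K -> J = K.
Proof.
move=> [J' -> [J1 J2]] [K' -> [K1 K2]].
by apply/seteqP; split; [exact: K2|exact: J2].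
Qed.

(* The default value [set0], not an ideal, would be taken only if there  *)
(* were no largest ideal.                                                *)
Definition jacobson (F : fieldType) (A : novikovType F) : set A :=
  xget set0 (@largest_J_ideal F A).
Arguments jacobson {F} A.

Lemma jacobson_eq (F : fieldType) (A : novikovType F) (J : set A) :
  largest_J_ideal J -> jacobson A = J.
Proof.
by move=> hJ; apply: largest_J_ideal_unique (hJ); apply: (xgetI set0 hJ).
Qed.

(* Main.v *)
(* In an irreducible right module the operators commute, so they lie in   *)
(* a field K, and the module is given by a map r : A -> K.  The           *)
(* R-identities of degree at most 3 force r either to be multiplicative   *)
(* or to satisfy r(xy) = r(x)r(y) + alpha(x)beta(y) with                  *)
(* alpha(xy) = alpha(x)r(y); then r, resp. alpha, exhibits the module as  *)
(* a quotient of the right module A itself.  It follows that irreducible  *)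
(* modules of an ideal I extend to A (I is a right A-module, and the      *)
(* kernel of r, resp. alpha, is stable under A), and that irreducible     *)
(* A-modules not annihilated by I stay irreducible over I.  Hence J(A) is *)
(* the largest ideal contained in the common kernel of the irreducible    *)
(* representations, and for N = J(I) the ideals N + aN + Na of I still    *)
(* lie in that kernel, so that N is an ideal of A.                        *)

From HB Require Import structures.
Require Import Defs.
From mathcomp Require Import all_boot all_order all_algebra.
From mathcomp Require Import boolp classical_sets.
From mathcomp Require Import ring.

Set Implicit Arguments.
Unset Strict Implicit.
Unset Printing Implicit Defensive.

Import GRing.Theory.
Local Open Scope ring_scope.
Local Open Scope classical_set_scope.

(** Let [M] be an irreducible right module. Right commutativity makes the operators commute, and by
    Schur's lemma their bicommutant is a field K, so the action is a linear map r into K. The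
    identity (g,xy,z) = (g,x,z)y gives D_z(xy) = D_z(x) r(y) for the defect D_z(x) = r(xz) - r(x)
    r(z). If all defects vanish, r is multiplicative; otherwise left symmetry forces D_y(x) =
    alpha(x) beta(y), with alpha a nonzero D_z ([schur_dichotomy]). So gamma = r or gamma = alpha
    maps the right regular module to K.

    This yields two transfer results: irreducible modules not killed by I stay irreducible over I
    ([simple_rep_restrict]), and irreducible I-modules extend to A ([simple_rep_extend]). Hence an
    ideal is in the radical class exactly when all irreducible representations of A vanish on it,
    and J(A) is the largest such ideal ([jacobsonE]). By extension, J(A) meets I inside J(I).
    Conversely, for N = J(I) the ideal N + aN + Na of I still lies in the kernel ([absorb_kernel]),
    so N is an ideal of A, and restriction puts it in J(A). *)

(** * Consequences of the Novikov identities *)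

Section NovikovIdentities.
Variable F : fieldType.

Lemma nmul0l (A : nalgType F) (x : A) : nmul 0 x = 0.
Proof. by rewrite -[X in nmul X _](scale0r (0 : A)) nmulZl scale0r. Qed.
Lemma nmulr0 (A : nalgType F) (x : A) : nmul x 0 = 0.
Proof. by rewrite -[X in nmul _ X](scale0r (0 : A)) nmulZr scale0r. Qed.
Lemma nmulNl (A : nalgType F) (x y : A) : nmul (- x) y = - nmul x y.
Proof. by rewrite -scaleN1r nmulZl scaleN1r. Qed.
Lemma nmulBl (A : nalgType F) (x y z : A) :
  nmul (x - y) z = nmul x z - nmul y z.
Proof. by rewrite nmulDl nmulNl. Qed.

(** Left symmetry brings [g] to the middle; in (xy,g,z) right commutativity then moves [y] to the
    far right of both terms. *)
Lemma nassoc_mulr (A : novikovType F) (g x y z : A) :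
  nassoc g (nmul x y) z = nmul (nassoc g x z) y.
Proof.
rewrite 2!(nov_lsym g) /nassoc nmulBl [nmul (nmul x y) g]nov_rcomm.
by rewrite [nmul _ z]nov_rcomm [nmul (nmul x y) _]nov_rcomm.
Qed.

Lemma nmul_lsym (A : novikovType F) (x y z : A) :
  nmul x (nmul y z) = nmul (nmul x y) z - nmul (nmul y x) z + nmul y (nmul x z).
Proof.
have /eqP := nov_lsym x y z; rewrite /nassoc subr_eq => /eqP ->.
by rewrite -addrA [- _ + _ in RHS]addrC -opprB addrAC addNr add0r.
Qed.

Lemma ideal_memD (A : novikovType F) (I : ideal A) (x y : A) :
  (I : set A) x -> (I : set A) y -> (I : set A) (x + y).
Proof. by rewrite -[x in x + y]scale1r; apply: idealP. Qed.

Lemma ideal_memB (A : novikovType F) (I : ideal A) (x y : A) :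
  (I : set A) x -> (I : set A) y -> (I : set A) (x - y).
Proof. by move=> Ix Iy; rewrite -scaleN1r addrC; apply: idealP. Qed.

End NovikovIdentities.

(** * Induction and substitution in free Novikov and tensor algebras *)

Section Substitution.
Variable F : fieldType.

Lemma freeNov_ind (P : freeNov F -> Prop) :
  (forall i, P (fvar F i)) ->
  (forall c f g, P f -> P g -> P (c *: f + g)) ->
  (forall f g, P f -> P g -> P (nmul f g)) ->
  forall f, P f.
Proof.
move=> Pvar Plin Pmul.
have P0 : P 0 by rewrite -(addNr (fvar F 0)) -scaleN1r; apply: Plin.
elim/pres_ind; elim=> [i||s Ps t Pt|s Ps|c s Ps|s Ps t Pt].
- exact: Pvar.
- exact: P0.
- by rewrite pclsDE -[pcls _ s]scale1r; apply: Plin.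
- by rewrite pclsNE -[- _]addr0 -scaleN1r; apply: Plin.
- by rewrite pclsZE -[_ *: _]addr0; apply: Plin.
- by rewrite pclsME; apply: Pmul.
Qed.

Lemma tensor_ind (V : lmodType F) (P : tensor_algebra V -> Prop) :
  P uone -> (forall v, P (tensor_in v)) ->
  (forall c S T, P S -> P T -> P (c *: S + T)) ->
  (forall S T, P S -> P T -> P (nmul S T)) ->
  forall T, P T.
Proof.
move=> P1 Pin Plin Pmul.
have P0 : P 0 by rewrite -(addNr uone) -scaleN1r; apply: Plin.
elim/pres_ind; elim=> [[v|]||s Ps t Pt|s Ps|c s Ps|s Ps t Pt].
- exact: Pin.
- exact: P1.
- exact: P0.
- by rewrite pclsDE -[pcls _ s]scale1r; apply: Plin.
- by rewrite pclsNE -[- _]addr0 -scaleN1r; apply: Plin.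
- by rewrite pclsZE -[_ *: _]addr0; apply: Plin.
- by rewrite pclsME; apply: Pmul.
Qed.

Lemma fsubst_comp (A B : novikovType F) (h : {linear A -> B}) (a : nat -> A) :
  (forall x y, h (nmul x y) = nmul (h x) (h y)) ->
  fsubst (h \o a) =1 h \o fsubst a.
Proof.
move=> hM f; rewrite -(fsubst_unique (h := h \o fsubst a)) //=.
- by move=> x y; rewrite fsubstM hM.
- by move=> i; rewrite fsubst_var.
Qed.

Lemma eq_tensor_lift (V : lmodType F) (B : ualgType F)
    (phi psi : {linear V -> B}) :
  phi =1 psi -> tensor_lift phi =1 tensor_lift psi.
Proof.
move=> eq_phi T; apply: (tensor_lift_unique (h := tensor_lift phi)).
- exact: tensor_lift1.
- exact: tensor_liftM.
- by move=> v; rewrite -eq_phi; apply: tensor_liftE.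
Qed.

Lemma tensor_lift_map (V W : lmodType F) (B : ualgType F)
    (f : {linear V -> W}) (phi : {linear W -> B}) T :
  tensor_lift phi (tensor_map f T) = tensor_lift (phi \o f) T.
Proof.
rewrite -(tensor_lift_unique (phi := phi \o f)
  (h := tensor_lift phi \o tensor_lift (tensor_in \o f))) //=.
- by rewrite !tensor_lift1.
- by move=> x y; rewrite !tensor_liftM.
- by move=> v; rewrite !tensor_liftE.
Qed.

Lemma fsubst_finite (f : freeNov F) : exists n,
  forall (A : novikovType F) (a b : nat -> A),
    (forall i, (i < n)%N -> a i = b i) -> fsubst a f = fsubst b f.
Proof.
elim/freeNov_ind: f => [i|c f g [m hm] [n hn]|f g [m hm] [n hn]].
- by exists i.+1 => A a b ab; rewrite !fsubst_var ab.
- exists (maxn m n) => A a b ab; rewrite !linearP /= (hm _ a b) ?(hn _ a b) // => i;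
    by move=> im; apply: ab; rewrite leq_max im ?orbT.
- exists (maxn m n) => A a b ab; rewrite !fsubstM (hm _ a b) ?(hn _ a b) // => i;
    by move=> im; apply: ab; rewrite leq_max im ?orbT.
Qed.

(** Provides a fresh variable, which can stand for the module element acted upon. *)
Lemma tensor_map_finite (G : tensor_algebra (freeNov F)) : exists n,
  forall (A : novikovType F) (a b : nat -> A),
    (forall i, (i < n)%N -> a i = b i) ->
    tensor_map (fsubst a) G = tensor_map (fsubst b) G.
Proof.
rewrite /tensor_map.
elim/tensor_ind: G => [|f|c S T [m hm] [n hn]|S T [m hm] [n hn]].
- by exists 0%N => A a b _; rewrite !tensor_lift1.
- have [n hn] := fsubst_finite f.
  by exists n => A a b ab; rewrite !tensor_liftE /= (hn _ a b).
- exists (maxn m n) => A a b ab; rewrite !linearP /= (hm _ a b) ?(hn _ a b) // => i;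
    by move=> im; apply: ab; rewrite leq_max im ?orbT.
- exists (maxn m n) => A a b ab.
  by rewrite !tensor_liftM (hm _ a b) ?(hn _ a b) // => i im; apply: ab;
    rewrite leq_max im ?orbT.
Qed.

End Substitution.

(** * Endomorphisms acting on the right, and multiplication of an ideal by A *)

Section Action.
Variables (F : fieldType) (M : lmodType F).
Implicit Types (m : M) (f g : endo M).

Lemma act1 m : act m (uone : endo M) = m. Proof. by []. Qed.
Lemma actPr m c f g : act m (c *: f + g) = c *: act m f + act m g.
Proof. by []. Qed.
Lemma actPl c m n f : act (c *: m + n) f = c *: act m f + act n f.
Proof. exact: (linearP (f : {linear M -> M})). Qed.
Lemma act0l f : act 0 f = 0. Proof. exact: (raddf0 (f : {linear M -> M})). Qed.

End Action.

Section IdealActions.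
Variables (F : fieldType) (A : novikovType F) (I : ideal A).
Implicit Types (x y : ideal_alg I) (a b : A).

Definition in_ideal a (Ia : ideal_set I a) : ideal_alg I :=
  exist _ a (introT (ideal_predP I a) Ia).

Lemma ideal_valP x : ideal_set I (val x). Proof. exact/ideal_predP/valP. Qed.

Definition ideal_lact a x : ideal_alg I := in_ideal (Defs.idealMl a (ideal_valP x)).
Definition ideal_ract x a : ideal_alg I := in_ideal (Defs.idealMr a (ideal_valP x)).

Lemma val_ideal0 : val (0 : ideal_alg I) = 0.
Proof. exact: raddf0. Qed.
Lemma val_idealD x y : val (x + y) = val x + val y.
Proof. exact: raddfD. Qed.
Lemma val_idealB x y : val (x - y) = val x - val y.
Proof. exact: raddfB. Qed.
Lemma val_idealZ (c : F) x : val (c *: x) = c *: val x.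
Proof. exact: linearZ. Qed.
Lemma val_lact a x : val (ideal_lact a x) = nmul a (val x). Proof. by []. Qed.
Lemma val_ract x a : val (ideal_ract x a) = nmul (val x) a. Proof. by []. Qed.
Lemma val_nmul x y : val (nmul x y) = nmul (val x) (val y). Proof. by []. Qed.

Definition val_idealE :=
  (val_ideal0, val_idealD, val_idealB, val_idealZ, val_lact, val_ract, val_nmul).

Lemma ideal_ractP x c a b :
  ideal_ract x (c *: a + b) = c *: ideal_ract x a + ideal_ract x b.
Proof. by apply: val_inj; rewrite linearP !val_ract nmulDr nmulZr. Qed.

End IdealActions.

(** * The regular representation, its quotients, and R-identities of low degree *)

Section RightRepresentations.
Variables (F : fieldType) (A : novikovType F).

Lemma fsubst_act (a : nat -> A) (f : freeNov F) T :
  fsubst a (act f (tensor_lift (rmul (freeNov F)) T)) =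
  act (fsubst a f) (tensor_lift (rmul A) (tensor_map (fsubst a) T)).
Proof.
rewrite tensor_lift_map.
elim/tensor_ind: T f => [|g|c S T IHS IHT|S T IHS IHT] f.
- by rewrite !tensor_lift1.
- by rewrite !tensor_liftE; apply: fsubstM.
- by rewrite !tensor_lift_linear !actPr fsubst_linear IHS IHT.
- by rewrite !tensor_liftM !actM IHT IHS.
Qed.

(* The acted-upon element is substituted for a variable absent from the  *)
(* R-identity.                                                           *)
Lemma right_rep_rmul : right_rep (rmul A).
Proof.
move=> G G0 a; apply: endoP => x.
have [n hn] := tensor_map_finite G.
pose b i := if i == n then x else a i.
have -> : tensor_map (fsubst a) G = tensor_map (fsubst b) G.
  by apply: hn => i; rewrite /b; case: eqP => // ->; rewrite ltnn.
have -> : x = fsubst b (fvar F n) by rewrite fsubst_var /b eqxx.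
by rewrite -fsubst_act G0; apply: raddf0.
Qed.

(** R-identities hold in the regular module A, hence on its submodule I, hence on every quotient of
    I. *)
Lemma right_rep_ideal_quotient (I : ideal A) (M : lmodType F)
    (rho : {linear A -> endo M}) (phi : {linear ideal_alg I -> M}) :
  (forall m, exists x, phi x = m) ->
  (forall x a, phi (ideal_ract x a) = act (phi x) (rho a)) ->
  right_rep rho.
Proof.
move=> phi_surj phi_act G G0 a; apply: endoP => m; have [x <-] := phi_surj m.
(* The action of any tensor on [phi x] lifts to its action on [x] in A, which stays in I. *)
have [y [+ <-]] : exists y : ideal_alg I,
    val y = act (val x) (tensor_lift (rmul A) (tensor_map (fsubst a) G)) /\
    phi y = act (phi x) (tensor_lift rho (tensor_map (fsubst a) G)).
  elim/tensor_ind: (tensor_map _ _) x => [|b|c S T IHS IHT|S T IHS IHT] x.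
  - by exists x; rewrite !tensor_lift1 !act1.
  - by exists (ideal_ract x b); rewrite !tensor_liftE.
  - have [y [vy py]] := IHS x; have [z [vz pz]] := IHT x.
    by exists (c *: y + z); rewrite !tensor_lift_linear !actPr !linearP /= vy vz py pz.
  - have [y [vy py]] := IHS x; have [z [vz pz]] := IHT y.
    by exists z; rewrite !tensor_liftM !actM vz pz vy py.
rewrite right_rep_rmul // => y0.
by rewrite (_ : y = 0) ?raddf0 //; apply: val_inj; rewrite y0 raddf0.
Qed.

Variables (M : lmodType F) (rho : {linear A -> endo M}).
Hypothesis rho_rep : right_rep rho.

Lemma right_rep_comm x y : nmul (rho x) (rho y) = nmul (rho y) (rho x).
Proof.
pose v i : tensor_algebra (freeNov F) := tensor_in (fvar F i).
have := rho_rep (G := nmul (v 0) (v 1) - nmul (v 1) (v 0)) _ (nth 0 [:: x; y]).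
rewrite /R_identity tensor_lift_map !raddfB /= !tensor_liftM !tensor_liftE /=.
rewrite !fsubst_var /= => h; apply/eqP; rewrite -subr_eq0; apply/eqP; apply: h; apply: endoP => g.
apply/eqP; rewrite subr_eq0; apply/eqP; exact: nov_rcomm.
Qed.

(** This is [nassoc_mulr] read as an identity between operators applied to [g]. *)
Lemma right_rep_mul x y z :
  rho (nmul (nmul x y) z) - nmul (rho (nmul x y)) (rho z) =
  nmul (rho (nmul x z) - nmul (rho x) (rho z)) (rho y).
Proof.
pose v := fvar F.
pose w f : tensor_algebra (freeNov F) := tensor_in f.
have := rho_rep (G := w (nmul (nmul (v 0) (v 1)) (v 2))
    - nmul (w (nmul (v 0) (v 1))) (w (v 2))
    - nmul (w (nmul (v 0) (v 2)) - nmul (w (v 0)) (w (v 2))) (w (v 1))) _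
  (nth 0 [:: x; y; z]).
rewrite /R_identity tensor_lift_map !raddfB /= !tensor_liftM !raddfB /=.
rewrite !tensor_liftM !tensor_liftE /= !fsubstM !fsubst_var /=.
move=> h; apply/eqP; rewrite -subr_eq0; apply/eqP; apply: h.
apply: endoP => g; apply/eqP; rewrite subr_eq0; apply/eqP.
transitivity (- nassoc g (nmul (v 0) (v 1)) (v 2)); first by rewrite opprB.
by rewrite nassoc_mulr -nmulNl opprB.
Qed.

End RightRepresentations.

(** * The field generated by an irreducible action *)

Section SchurField.
Variables (F : fieldType) (A : novikovType F) (M : lmodType F).
Variable rho : {linear A -> endo M}.

Definition simple_rep : Prop := right_rep rho /\ irreducible_rep rho.

Definition centralizes (f : endo M) : Prop :=
  forall a, nmul f (rho a) = nmul (rho a) f.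

(** The bicommutant contains [rho a], is commutative because the [rho a] commute, and is closed
    under inverses. *)
Definition bicentral : pred (endo M) :=
  fun f => `[< forall g, centralizes g -> nmul f g = nmul g f >].

Lemma bicentralP f :
  reflect (forall g, centralizes g -> nmul f g = nmul g f) (f \in bicentral).
Proof. exact: asboolP. Qed.

Lemma bicentral_submod : submod_closed bicentral.
Proof.
split=> [|c f g /bicentralP fC /bicentralP gC]; apply/bicentralP => h hC.
  by apply: endoP => m; rewrite !actM act0l.
by rewrite nmulDl nmulDr nmulZl nmulZr fC // gC.
Qed.
HB.instance Definition _ :=
  GRing.isSubmodClosed.Build F (endo M) bicentral bicentral_submod.

(** Schur's lemma: kernel and image of [f] are submodules. *)
Lemma schur_inverse f : irreducible_rep rho -> centralizes f -> f != 0 ->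
  exists2 g, nmul f g = uone & nmul g f = uone.
Proof.
move=> [irr _] fC f0.
have f_ex : exists m, act m f != 0.
  apply/not_existsP => /= fE; move/eqP: f0; apply; apply: endoP => m.
  exact/eqP/negPn/negP/fE.
have [m0 fm0] := f_ex.
have fM m a : act (act m (rho a)) f = act (act m f) (rho a).
  by rewrite -!actM fC.
have f_inj m n : act m f = act n f -> m = n.
  have kerf : submodule rho [set m | act m f = 0].
    split=> [|c u v /= fu fv|u a /= fu]; first exact: act0l.
      by rewrite actPl fu fv scaler0 addr0.
    by rewrite fM fu act0l.
  case: (irr _ kerf) => [ker0|kerT].
    move=> fmn; have : [set m | act m f = 0] (-1 *: n + m).
      by rewrite /= actPl fmn scaleN1r addNr.
    by rewrite ker0 /= scaleN1r addrC => /eqP; rewrite subr_eq0 => /eqP.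
  have : [set m | act m f = 0] m0 by rewrite kerT.
  by move=> /= fm00; rewrite fm00 eqxx in fm0.
have f_surj m : exists n, act n f = m.
  have imf : submodule rho [set m | exists n, act n f = m].
    split=> [|c u v /= [u' <-] [v' <-]|u a /= [u' <-]].
    - by exists 0; apply: act0l.
    - by exists (c *: u' + v'); apply: actPl.
    - by exists (act u' (rho a)).
  case: (irr _ imf) => [im0|imT].
    have : [set m | exists n, act n f = m] (act m0 f) by exists m0.
    by rewrite im0 /= => fm00; rewrite fm00 eqxx in fm0.
  by have : [set m | exists n, act n f = m] m by rewrite imT.
have [g gP] := choice f_surj.
have glin : linear g by move=> c u v; apply: f_inj; rewrite actPl !gP.
pose g' : {linear M -> M} := HB.pack g (GRing.isLinear.Build _ _ _ _ g glin).
have g'E m : act m (g' : endo M) = g m by [].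
by exists (g' : endo M); apply: endoP => m; [apply: f_inj|];
  rewrite actM g'E gP.
Qed.

Definition schur_field of simple_rep : Type := {f | f \in bicentral}.

Variable H : simple_rep.
Local Notation K := (schur_field H).
HB.instance Definition _ := Choice.on K.
HB.instance Definition _ := SubType.on K.
HB.instance Definition _ := [SubChoice_isSubLmodule of K by <:].

Lemma rho_centralizes a : centralizes (rho a).
Proof. by move=> b; apply: right_rep_comm H.1 _ _. Qed.

Lemma bicentral_centralizes f : f \in bicentral -> centralizes f.
Proof. by move=> /bicentralP fC a; apply/fC/rho_centralizes. Qed.

Lemma schur_mulP (f g : K) : nmul (val f) (val g) \in bicentral.
Proof.
apply/bicentralP => h hC.
rewrite -endo_mulA (bicentralP _ (valP g)) // endo_mulA.
by rewrite (bicentralP _ (valP f)) // endo_mulA.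
Qed.
Lemma schur_oneP : (uone : endo M) \in bicentral.
Proof. by apply/bicentralP => h _; rewrite endo_mul1l endo_mul1r. Qed.

Definition schur_one : K := exist _ uone schur_oneP.
Definition schur_mul (f g : K) : K := exist _ (nmul (val f) (val g)) (schur_mulP f g).

Lemma schur_mulA : associative schur_mul.
Proof. by move=> f g h; apply: val_inj; apply: endo_mulA. Qed.
Lemma schur_mulC : commutative schur_mul.
Proof.
move=> f g; apply: val_inj; apply: (bicentralP _ (valP f)).
exact: bicentral_centralizes (valP g).
Qed.
Lemma schur_mul1 : left_id schur_one schur_mul.
Proof. by move=> f; apply: val_inj; apply: endo_mul1l. Qed.
Lemma schur_mulDl : left_distributive schur_mul +%R.
Proof. by move=> f g h; apply: val_inj; apply: nmulDl. Qed.
Lemma schur_one_neq0 : schur_one != 0.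
Proof.
have [m [a ma]] := H.2.2; apply: contraNneq ma => one0.
have : act m (rho a) = act (act m (rho a)) (val schur_one) by [].
by rewrite one0 => ->.
Qed.
HB.instance Definition _ := GRing.Zmodule_isComNzRing.Build K
  schur_mulA schur_mulC schur_mul1 schur_mulDl schur_one_neq0.

(** The default value is taken only at zero, giving the convention that 0 is its own inverse. *)
Definition schur_inv (f : K) : K := xget 0 [set g | g * f = 1].

Lemma schur_mulVf (f : K) : f != 0 -> schur_inv f * f = 1.
Proof.
move=> f0; suff : exists g, [set g : K | g * f = 1] g by move/(xgetPex 0).
have f0' : val f != 0 by apply: contra_neq f0 => f0; apply: val_inj.
have [g fg gf] :=
  schur_inverse H.2 (bicentral_centralizes (valP f)) f0'.
have gP : g \in bicentral.
  apply/bicentralP => h hC.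
  have -> : nmul g h = nmul (nmul g h) (nmul (val f) g).
    by rewrite fg; apply/esym/endo_mul1r.
  rewrite endo_mulA -[nmul (nmul g h) _]endo_mulA -(bicentralP _ (valP f)) //.
  rewrite [nmul g (nmul _ h)]endo_mulA gf; congr nmul; exact: endo_mul1l.
by exists (exist _ g gP); apply: val_inj.
Qed.

Lemma schur_inv0 : schur_inv 0 = 0.
Proof.
by apply: xgetPN => g /=; rewrite mulr0 => /esym/eqP; rewrite oner_eq0.
Qed.
HB.instance Definition _ :=
  GRing.ComNzRing_isField.Build K schur_mulVf schur_inv0.

Definition schur_rep (a : A) : K :=
  exist _ (rho a) (introT (bicentralP _) (fun g gC => esym (gC a))).
Lemma schur_rep_linear : linear schur_rep.
Proof. by move=> c a b; apply: val_inj; rewrite [RHS]linearP; apply: linearP. Qed.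
HB.instance Definition _ :=
  GRing.isLinear.Build F A K _ schur_rep schur_rep_linear.

Lemma schur_rep_mul x y z :
  schur_rep (nmul (nmul x y) z) - schur_rep (nmul x y) * schur_rep z =
  (schur_rep (nmul x z) - schur_rep x * schur_rep z) * schur_rep y.
Proof. by apply: val_inj; rewrite !raddfB; apply: right_rep_mul H.1 _ _ _. Qed.

Lemma schur_scaler_mul c (f g : K) : (c *: f) * g = c *: (f * g).
Proof. by apply: val_inj; apply: nmulZl. Qed.

Lemma schur_rep_neq0 : exists a, schur_rep a != 0.
Proof.
have [m [a ma]] := H.2.2; exists a; apply: contra_neq ma => /(congr1 val) /= ->.
by [].
Qed.

End SchurField.

(** * K-valued maps with a rank-one multiplicative defect *)

Section Jets.
Variables (K : fieldType) (F : fieldType).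

Lemma morph_nassoc (A : novikovType F) (f : A -> K) :
  {morph f : x y / x - y} -> forall x y z,
  f (nmul (nmul x y) z) - f (nmul x (nmul y z)) =
  f (nmul (nmul y x) z) - f (nmul y (nmul x z)).
Proof. by move=> fB x y z; rewrite -!fB; congr f; apply: nov_lsym. Qed.

(** Additive maps from the right regular module to K that turn right multiplication by [y] into the
    scalar [r y]. *)
Definition semi_mult (A : novikovType F) (alpha r : A -> K) : Prop :=
  {morph alpha : x y / x - y} /\
  forall x y, alpha (nmul x y) = alpha x * r y.

(* In the Novikov algebra [x y'] of a differential algebra, the maps     *)
(* [x], [x'] and [x''] have these properties of [alpha], [r] and [beta]. *)
Definition jet (A : novikovType F) (alpha r beta : A -> K) : Prop :=
  [/\ semi_mult alpha r, {morph r : x y / x - y}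
    & forall x y, r (nmul x y) = r x * r y + alpha x * beta y].

(** Apply [alpha] to left symmetry. It follows that each defect is proportional to [alpha] once
    [alpha] is nonzero. *)
Lemma semi_mult_defect (A : novikovType F) (alpha r : A -> K) x y z :
  semi_mult alpha r ->
  alpha x * (r (nmul y z) - r y * r z) = alpha y * (r (nmul x z) - r x * r z).
Proof.
move=> [alphaB alphaM]; have := morph_nassoc alphaB x y z.
rewrite !alphaM => h; apply/eqP; rewrite -subr_eq0.
set u := _ - _; have -> : u = alpha y * r x * r z - alpha y * r (nmul x z)
  - (alpha x * r y * r z - alpha x * r (nmul y z)) by rewrite /u; ring.
by rewrite h subrr.
Qed.

Lemma jet_of_defect (A : novikovType F) (r : A -> K) (x0 z0 : A) :
  {morph r : x y / x - y} ->
  (forall x y z, r (nmul (nmul x y) z) - r (nmul x y) * r z =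
                 (r (nmul x z) - r x * r z) * r y) ->
  r (nmul x0 z0) - r x0 * r z0 != 0 ->
  exists beta, jet (fun x => r (nmul x z0) - r x * r z0) r beta.
Proof.
move=> rB rM; pose alpha x := r (nmul x z0) - r x * r z0.
rewrite -/(alpha x0) -/alpha => alpha0.
have alphaP : semi_mult alpha r.
  split=> [x y|x y]; last exact: rM.
  by rewrite /alpha nmulBl !rB; ring.
exists (fun y => (r (nmul x0 y) - r x0 * r y) / alpha x0); split=> // x y.
have := semi_mult_defect x x0 y alphaP; set d := r (nmul x0 y) - _ => h.
by rewrite mulrA h mulrAC divff // mul1r addrC subrK.
Qed.

Section JetIdeal.
Variables (A : novikovType F) (I : ideal A) (alpha r beta : A -> K).
Hypothesis jetP : jet alpha r beta.

(** Apply [r] to left symmetry. In the model, (yz')'' = y''z' + 2y'z'' + yz''', so the bracket after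
    [alpha x] is -yz'''. *)
Lemma jet_sym x y z :
  alpha x * (beta y * r z + (r y * beta z) *+ 2 - beta (nmul y z)) =
  alpha y * (beta x * r z + (r x * beta z) *+ 2 - beta (nmul x z)).
Proof.
have [[alphaB alphaM] rB rM] := jetP; have := morph_nassoc rB x y z.
rewrite !rM !alphaM => h; apply/eqP; rewrite -subr_eq0.
by move/eqP: h; rewrite -subr_eq0 => /eqP <-; apply/eqP; ring.
Qed.

(** [alpha] is nonzero at [x0 l]. If [beta] vanished on I, [jet_sym] at [x0 l], [y0], [l] would
    leave only a nonzero product equal to zero. *)
Lemma jet_ideal l x0 y0 : (I : set A) l ->
  r l != 0 -> alpha x0 != 0 -> beta y0 != 0 ->
  (exists2 x, (I : set A) x & alpha x != 0) /\
  (exists2 y, (I : set A) y & beta y != 0).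
Proof.
move=> Il rl0 alpha0 beta0; have [[alphaB alphaM] rB rM] := jetP.
have Ix1 : (I : set A) (nmul x0 l) by apply: Defs.idealMl.
have alpha1 : alpha (nmul x0 l) != 0 by rewrite alphaM mulf_neq0.
split; first by exists (nmul x0 l).
apply/not_exists2P => betaI.
have {}betaI y : (I : set A) y -> beta y = 0.
  by move=> Iy; have [//|/negP/negPn/eqP] := betaI y.
have [Ixl Iyl] : (I : set A) (nmul (nmul x0 l) l) /\ (I : set A) (nmul y0 l).
  by split; apply: Defs.idealMl.
have := jet_sym (nmul x0 l) y0 l.
rewrite (betaI _ Il) (betaI _ Ix1) (betaI _ Ixl) (betaI _ Iyl) !(mulr0, mul0r, mul0rn, addr0, subr0) => /eqP.
by rewrite mulf_eq0 (negPf alpha1) mulf_eq0 (negPf beta0) (negPf rl0).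
Qed.
End JetIdeal.

Section JetExtension.
Variables (A : novikovType F) (I : ideal A).
Implicit Types x y : ideal_alg I.

(** Left symmetry of [x], [y], [a] in A, written with (xy)a = (xa)y so that [r] is evaluated only on
    I. *)
Lemma semi_mult_ract (alpha r : ideal_alg I -> K) a x y :
  semi_mult alpha r ->
  alpha (ideal_ract x a) * r y - alpha (ideal_ract y a) * r x =
  alpha x * r (ideal_ract y a) - alpha y * r (ideal_ract x a).
Proof.
move=> [alphaB alphaM]; rewrite -!alphaM.
have ractE u v : nmul (ideal_ract u a) v = ideal_ract (nmul u v) a.
  by apply: val_inj; apply: nov_rcomm.
rewrite !ractE -!alphaB; congr alpha; apply: val_inj.
rewrite !raddfB /=.
have /eqP := nov_lsym (val x) (val y) a; rewrite subr_eq => /eqP ->.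
by rewrite addrAC [_ - _ - _]addrAC subrr add0r addrC.
Qed.

(** For [alpha] equal to [r] the previous identity says that twice the difference is zero; this is
    where characteristic 2 is excluded. *)
Lemma mult_ract (r : ideal_alg I -> K) a x y : 2%:R != 0 :> K ->
  semi_mult r r -> r (ideal_ract x a) * r y = r (ideal_ract y a) * r x.
Proof.
move=> two_neq0 /(semi_mult_ract a x y) h; apply/eqP; rewrite -subr_eq0.
have: (r (ideal_ract x a) * r y - r (ideal_ract y a) * r x) *+ 2 == 0.
  by rewrite mulr2n {1}h; apply/eqP; ring.
by rewrite -mulr_natr mulf_eq0 (negPf two_neq0) orbF.
Qed.

(* Writing [f x = alpha (x a)], the determinant of [f], [r] and [alpha]  *)
(* at three points vanishes; multiplying the first point by [w] adds     *)
(* [alpha u * beta w] to its [r]-entry and leaves only a 2x2 minor.      *)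
Lemma jet_ract (alpha r beta : ideal_alg I -> K) a x y :
  jet alpha r beta ->
  (exists u, alpha u != 0) -> (exists w, beta w != 0) ->
  alpha (ideal_ract x a) * alpha y = alpha (ideal_ract y a) * alpha x.
Proof.
move=> [alphaP rB rM] [u alpha_u] [w beta_w].
pose f v := alpha (ideal_ract v a).
pose det v := f v * (r x * alpha y - r y * alpha x)
  + f x * (r y * alpha v - r v * alpha y) + f y * (r v * alpha x - r x * alpha v).
have det0 v : det v = 0.
  have := semi_mult_ract a v x alphaP; have := semi_mult_ract a x y alphaP.
  have := semi_mult_ract a y v alphaP; rewrite -/(f v) -/(f x) -/(f y) => h1 h2 h3.
  transitivity (alpha v * (f x * r y - f y * r x)
    + alpha x * (f y * r v - f v * r y) + alpha y * (f v * r x - f x * r v)).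
    by rewrite /det; ring.
  by rewrite h1 h2 h3; ring.
have fM : f (nmul u w) = f u * r w.
  rewrite /f -alphaP.2; congr alpha; apply: val_inj; apply: nov_rcomm.
have : det (nmul u w) - det u * r w =
    alpha u * beta w * (f y * alpha x - f x * alpha y).
  by rewrite /det fM rM alphaP.2; ring.
rewrite !det0 mul0r subr0 => /esym/eqP.
by rewrite !mulf_eq0 (negPf alpha_u) (negPf beta_w) subr_eq0 => /eqP.
Qed.

End JetExtension.
End Jets.

(** * Irreducible modules: multiplicative or jet type *)

Section Dichotomy.
Variables (F : fieldType) (A : novikovType F) (M : lmodType F).
Variables (rho : {linear A -> endo M}) (H : simple_rep rho).
Local Notation K := (schur_field H).
Local Notation r := (schur_rep H).

Lemma schur_act_mul m (f g : K) : act m (val (f * g)) = act (act m (val f)) (val g).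
Proof. by []. Qed.

Lemma schur_act_eq0 m (f : K) : act m (val f) = 0 -> f != 0 -> m = 0.
Proof.
move=> mf f0; have : act m (val (f * f^-1)) = 0 by rewrite schur_act_mul mf act0l.
by rewrite divff.
Qed.

(** The orbit is a submodule, nonzero because nonzero elements of K act injectively. *)
Lemma schur_orbit (V : lmodType F) (gamma : {linear V -> K}) x0 n :
  gamma x0 != 0 -> n != 0 ->
  (forall x a, exists y, gamma y = gamma x * r a) ->
  forall m, exists x, act n (val (gamma x)) = m.
Proof.
move=> gamma0 n0 gammaM m.
have sub : submodule rho [set m | exists x, act n (val (gamma x)) = m].
  split=> [|c _ _ /= [x <-] [y <-]|_ a /= [x <-]].
  - by exists 0; rewrite !raddf0.
  - by exists (c *: x + y); rewrite !linearP.
  - by have [y yE] := gammaM x a; exists y; rewrite yE.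
case: (H.2.1 _ sub) => [sub0|subT]; last first.
  by have : [set m | exists x, act n (val (gamma x)) = m] m by rewrite subT.
have : [set m | exists x, act n (val (gamma x)) = m] (act n (val (gamma x0))).
  by exists x0.
by rewrite sub0 /= => /schur_act_eq0 /(_ gamma0) n00; rewrite n00 eqxx in n0.
Qed.

Definition defect z x : K := r (nmul x z) - r x * r z.
Lemma defect_linear z : linear (defect z).
Proof.
move=> c x y; rewrite /defect nmulDl nmulZl !linearP /= mulrDl schur_scaler_mul.
by rewrite scalerBr opprD addrACA.
Qed.
HB.instance Definition _ z :=
  GRing.isLinear.Build F A K _ (defect z) (defect_linear z).

Lemma schur_dichotomy :
  semi_mult r r \/
  exists z beta, [/\ jet (defect z) r beta, exists x, defect z x != 0
    & exists y, beta y != 0].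
Proof.
have [[z [x xz]]|nodefect] := pselect (exists z x, defect z x != 0); [right|left].
  have [beta jetP] := jet_of_defect (raddfB _) (schur_rep_mul H) xz.
  exists z, beta; split=> //; first by exists x.
  (* The defect at [z] is [alpha] times [beta z], so [beta z] cannot vanish. *)
  exists z; apply: contra_neq xz => beta_z; have [_ _ rM] := jetP.
  by rewrite /defect rM beta_z mulr0 addr0 subrr.
split=> [|x y]; first exact: raddfB.
apply/eqP; rewrite -subr_eq0; apply/negPn/negP => xy.
by apply: nodefect; exists y, x.
Qed.

End Dichotomy.

(** * Restriction of irreducible modules to an ideal *)

Section Restriction.
Variables (F : fieldType) (A : novikovType F) (M : lmodType F).
Variable rho : {linear A -> endo M}.

Lemma right_rep_comp (B : novikovType F) (h : {linear B -> A}) :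
  (forall x y, h (nmul x y) = nmul (h x) (h y)) ->
  right_rep rho -> right_rep (rho \o h).
Proof.
move=> hM rho_rep G G0 a; rewrite tensor_lift_map.
rewrite -(rho_rep G G0 (h \o a)) tensor_lift_map.
by apply: eq_tensor_lift => f /=; rewrite fsubst_comp.
Qed.

(** If n is a nonzero element of an I-submodule [N], then n gamma(I) lies in [N]; it is a nonzero
    A-submodule since I is a right ideal, so it is [M]. *)
Lemma simple_rep_restrict (I : ideal A) : simple_rep rho ->
  (exists2 l, (I : set A) l & rho l != 0) ->
  simple_rep (rho \o (val : ideal_alg I -> A)).
Proof.
move=> H [l Il rho_l]; split; first exact: right_rep_comp H.1.
have rl0 : schur_rep H l != 0 by apply: contra_neq rho_l => /(congr1 val).
split; last first.
  have [m ml] : exists m, act m (rho l) != 0.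
    apply/not_existsP => mE; move/eqP: rho_l; apply; apply: endoP => m.
    exact/eqP/negPn/negP/mE.
  by exists m, (in_ideal Il).
move=> N [N0 NP NA].
have [gamma [gammaM [x0 gamma0] gammaN]] : exists gamma : {linear A -> schur_field H},
  [/\ forall x a, gamma (nmul x a) = gamma x * schur_rep H a,
      exists x0 : ideal_alg I, gamma (val x0) != 0
    & forall (x : ideal_alg I) n, N n -> N (act n (val (gamma (val x))))].
  case: (schur_dichotomy H) => [[_ rM]|[z [beta [jetP [x1 alpha1] [y1 beta1]]]]].
    exists (schur_rep H); split=> //; first by exists (in_ideal Il).
    by move=> x n; apply: NA.
  have [[x Ix alpha_x] [y Iy beta_y]] := jet_ideal jetP Il rl0 alpha1 beta1.
  (* Taking the defect at [y] in I makes its values on I polynomials in the operators of I, which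
     preserve [N]. *)
  exists (defect H y); split=> [u a||u n Nn].
  - exact: schur_rep_mul.
  - have [_ _ rM] := jetP; exists (in_ideal Ix).
    rewrite -[_ != 0]/(schur_rep H (nmul x y) - _ != 0) rM addrC addKr.
    exact: mulf_neq0.
  - have -> : act n (val (defect H y (val u))) =
        -1 *: act (act n (rho (val u))) (rho y) + act n (rho (nmul (val u) y)).
      by rewrite scaleN1r addrC /defect raddfB.
    apply: NP; last exact: (NA _ (ideal_ract u y) Nn).
    exact: (NA _ (in_ideal Iy) (NA _ u Nn)).
have [[n [Nn n0]]|N_triv] := pselect (exists n, N n /\ n != 0); last first.
  left; apply/seteqP; split=> [n Nn|_ -> //] /=.
  by apply/eqP/negPn/negP => n0; apply: N_triv; exists n.
right; apply/seteqP; split=> // m _.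
have [|x <-] := schur_orbit (gamma := gamma \o (val : ideal_alg I -> A)) gamma0 n0 _ m.
  by move=> x a; exists (ideal_ract x a); apply: gammaM.
exact: gammaN.
Qed.

End Restriction.

(** * Extension of irreducible modules from an ideal *)

Section Extension.
Variables (F : fieldType) (A : novikovType F) (I : ideal A) (M : lmodType F).
Variable rho : {linear ideal_alg I -> endo M}.

Lemma simple_rep_extend : 2%N \notin [pchar F] -> simple_rep rho ->
  exists2 rho' : {linear A -> endo M},
    simple_rep rho' & forall x, rho' (val x) = rho x.
Proof.
move=> F2 H; pose K := schur_field H; pose r : ideal_alg I -> K := schur_rep H.
have K2 : 2%:R != 0 :> K.
  by move: F2; rewrite inE /= -[2%:R in X in _ -> X]scaler_nat scaler_eq0 oner_eq0 orbF.
have [gamma [[gammaB gammaM] [u gamma_u] gamma_ract]] :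
    exists gamma : {linear ideal_alg I -> K},
    [/\ semi_mult gamma r, exists u, gamma u != 0 & forall a x y,
      gamma (ideal_ract x a) * gamma y = gamma (ideal_ract y a) * gamma x].
  case: (schur_dichotomy H) => [rM|[z [beta [jetP alpha0 beta0]]]].
    exists (schur_rep H); split=> //; first exact: schur_rep_neq0.
    by move=> a x y; apply: mult_ract.
  exists (defect H z); split=> //; first by case: jetP.
  by move=> a x y; apply: jet_ract jetP alpha0 beta0.
(* The scalar by which right multiplication by [a] acts through [gamma]; [gamma_ract] makes it
   independent of [u]. *)
pose c a : endo M := val (gamma (ideal_ract u a) / gamma u : K).
have c_linear : linear c.
  move=> k a b; rewrite /c ideal_ractP linearP mulrDl schur_scaler_mul.
  by rewrite linearP.
pose rho' : {linear A -> endo M} :=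
  HB.pack c (GRing.isLinear.Build _ _ _ _ c c_linear).
have rho'E x : rho' (val x) = rho x.
  rewrite -[LHS]/(c (val x)) /c; have -> : ideal_ract u (val x) = nmul u x by apply: val_inj.
  by rewrite gammaM mulrAC divff // mul1r.
exists rho' => //; have [m [y my]] := H.2.2; split; last first.
  split; last by exists m, (val y); rewrite rho'E.
  move=> N [N0 NP NA]; apply: H.2.1; split=> // n x Nn.
  by rewrite -rho'E; apply: NA.
have m0 : m != 0 by apply: contra_neq my => ->; rewrite act0l.
pose phi x := act m (val (gamma x)).
have phi_linear : linear phi by move=> k a b; rewrite /phi !linearP.
pose phi' : {linear ideal_alg I -> M} :=
  HB.pack phi (GRing.isLinear.Build _ _ _ _ phi phi_linear).
apply: (right_rep_ideal_quotient (phi := phi')).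
  apply: (schur_orbit gamma_u m0) => x a.
  by exists (nmul x a); apply: gammaM.
move=> x a; rewrite -[RHS]/(act (phi x) (c a)) -schur_act_mul; congr (act m (val _)).
by rewrite mulrCA mulrA gamma_ract mulfK.
Qed.

End Extension.

(** * The radical as the largest ideal in the common kernel *)

Section Radical.
Variable F : fieldType.
Hypothesis F2 : 2%N \notin [pchar F].

Definition common_kernel (A : novikovType F) : set A := [set a |
  forall (M : lmodType F) (rho : {linear A -> endo M}), simple_rep rho ->
  rho a = 0].

(** A representation of A nonzero on I restricts to an irreducible one of I, and an irreducible one
    of I extends to A. *)
Lemma in_J_ideal (A : novikovType F) (I : ideal A) :
  in_J (ideal_alg I) <-> I `<=` @common_kernel A.
Proof.
split=> [I_J a Ia M rho H|I_ker [M [rho H]]].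
  apply/eqP/negPn/negP => rho_a; apply: I_J; exists M.
  exists (rho \o (val : ideal_alg I -> A)).
  by apply: simple_rep_restrict => //; exists a.
have [m [x mx]] := H.2.2; have [rho' H' rho'E] := simple_rep_extend F2 H.
move: mx; rewrite -rho'E (I_ker _ (ideal_valP x) _ _ H') => /eqP; exact.
Qed.

Definition kernel_core (A : novikovType F) : set A :=
  [set a | exists2 L : ideal A, L `<=` @common_kernel A & (L : set A) a].

Lemma common_kernelP (A : novikovType F) c (a b : A) :
  common_kernel a -> common_kernel b -> common_kernel (c *: a + b).
Proof.
by move=> a0 b0 M rho H; rewrite linearP a0 // b0 // scaler0 addr0.
Qed.

Section IdealAdd.
Variables (A : novikovType F) (L1 L2 : ideal A).
Definition ideal_add_set : set A :=
  [set a | exists x y, [/\ (L1 : set A) x, (L2 : set A) y & a = x + y]].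
Lemma ideal_add0 : ideal_add_set 0.
Proof. by exists 0, 0; rewrite addr0; split=> //; apply: ideal0. Qed.
Lemma ideal_addP c a b :
  ideal_add_set a -> ideal_add_set b -> ideal_add_set (c *: a + b).
Proof.
move=> [x [y [Lx Ly ->]]] [u [v [Lu Lv ->]]].
exists (c *: x + u), (c *: y + v); rewrite scalerDr addrACA.
by split=> //; apply: idealP.
Qed.
Lemma ideal_addMl a b : ideal_add_set b -> ideal_add_set (nmul a b).
Proof.
move=> [x [y [Lx Ly ->]]]; exists (nmul a x), (nmul a y); rewrite nmulDr.
by split=> //; apply: Defs.idealMl.
Qed.
Lemma ideal_addMr a b : ideal_add_set a -> ideal_add_set (nmul a b).
Proof.
move=> [x [y [Lx Ly ->]]]; exists (nmul x b), (nmul y b); rewrite nmulDl.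
by split=> //; apply: Defs.idealMr.
Qed.
Definition ideal_add : ideal A :=
  Ideal ideal_add0 ideal_addP ideal_addMl ideal_addMr.
End IdealAdd.

Section KernelCore.
Variable A : novikovType F.
Lemma kernel_core0 : kernel_core (0 : A).
Proof.
have zP c (x y : A) : [set 0] x -> [set 0] y -> [set 0] (c *: x + y).
  by move=> /= -> ->; rewrite scaler0 addr0.
have zMl (x y : A) : [set 0] y -> [set 0] (nmul x y).
  by move=> /= ->; rewrite nmulr0.
have zMr (x y : A) : [set 0] x -> [set 0] (nmul x y).
  by move=> /= ->; rewrite nmul0l.
exists (@Ideal F A [set 0] erefl zP zMl zMr) => //= a -> M rho _.
exact: raddf0.
Qed.
Lemma kernel_coreP c (a b : A) :
  kernel_core a -> kernel_core b -> kernel_core (c *: a + b).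
Proof.
move=> [L1 L1k L1a] [L2 L2k L2b]; exists (ideal_add L1 L2); last first.
  exists (c *: a), b; split=> //.
  by rewrite -[_ *: _]addr0; apply: idealP => //; apply: ideal0.
move=> _ [x [y [/L1k xk /L2k yk ->]]].
by rewrite -[x]scale1r; apply: common_kernelP.
Qed.
Lemma kernel_coreMl (a b : A) : kernel_core b -> kernel_core (nmul a b).
Proof. by move=> [L Lk Lb]; exists L => //; apply: Defs.idealMl. Qed.
Lemma kernel_coreMr (a b : A) : kernel_core a -> kernel_core (nmul a b).
Proof. by move=> [L Lk La]; exists L => //; apply: Defs.idealMr. Qed.
Definition kernel_core_ideal : ideal A :=
  Ideal kernel_core0 kernel_coreP kernel_coreMl kernel_coreMr.
End KernelCore.

Lemma jacobsonE (A : novikovType F) : jacobson A = @kernel_core A.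
Proof.
apply: jacobson_eq; exists (kernel_core_ideal A) => //; split.
  by apply/in_J_ideal => a [L Lk La]; apply: Lk.
by move=> L /in_J_ideal Lk a La; exists L.
Qed.

End Radical.

(** * The radical of I is an ideal of A, and heredity *)

Section Heredity.
Variables (F : fieldType) (A : novikovType F) (I : ideal A).
Hypothesis F2 : 2%N \notin [pchar F].

Section Absorb.
Variables (N : ideal (ideal_alg I)) (a : A).

Definition absorb_set : set (ideal_alg I) := [set x | exists n1 n2 n3,
  [/\ (N : set _) n1, (N : set _) n2, (N : set _) n3
    & x = n1 + ideal_lact a n2 + ideal_ract n3 a]].

Lemma absorb0 : absorb_set 0.
Proof.
exists 0, 0, 0; split; try exact: ideal0.
by apply: val_inj; rewrite !val_idealE nmulr0 nmul0l !addr0.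
Qed.

Lemma absorbP c x y : absorb_set x -> absorb_set y -> absorb_set (c *: x + y).
Proof.
move=> [n1 [n2 [n3 [N1 N2 N3 ->]]]] [m1 [m2 [m3 [M1 M2 M3 ->]]]].
exists (c *: n1 + m1), (c *: n2 + m2), (c *: n3 + m3); split; try exact: idealP.
apply: val_inj; rewrite !val_idealE nmulDr nmulDl nmulZl nmulZr.
by rewrite !scalerDr addrACA; congr (_ + _); rewrite addrACA.
Qed.

Lemma absorbMr x y : absorb_set x -> absorb_set (nmul x y).
Proof.
move=> [n1 [n2 [n3 [N1 N2 N3 ->]]]].
(* Here (a n2)y = (ay)n2 falls into [N] because ay is in I. *)
exists (nmul n1 y + nmul (ideal_lact a y) n2), 0, (nmul n3 y); split.
- by apply: ideal_memD; [apply: Defs.idealMr|apply: Defs.idealMl].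
- exact: ideal0.
- exact: Defs.idealMr.
rewrite !nmulDl (_ : ideal_lact a 0 = 0) ?addr0.
  by congr (_ + _ + _); apply: val_inj; apply: nov_rcomm.
by apply: val_inj; rewrite !val_idealE nmulr0.
Qed.

Lemma absorbMl x y : absorb_set y -> absorb_set (nmul x y).
Proof.
move=> [n1 [n2 [n3 [N1 N2 N3 ->]]]].
(* Left symmetry expands x(a n2) and x(n3 a) as in [nmul_lsym]; xa and ax lie in I. *)
exists (nmul x n1 + (nmul (ideal_ract x a) n2 - nmul (ideal_lact a x) n2)
         + nmul n3 (ideal_ract x a)),
  (nmul x n2), (nmul x n3 - nmul n3 x); split.
- apply: ideal_memD; last exact: Defs.idealMr.
  apply: ideal_memD; first exact: Defs.idealMl.
  by apply: ideal_memB; apply: Defs.idealMl.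
- exact: Defs.idealMl.
- by apply: ideal_memB; [apply: Defs.idealMl|apply: Defs.idealMr].
rewrite !nmulDr; apply: val_inj; rewrite !val_idealE nmulBl.
rewrite [nmul (val x) (nmul a _)]nmul_lsym.
rewrite [nmul (val x) (nmul (val n3) _)]nmul_lsym.
by rewrite [in LHS](addrA (nmul _ (val n1))) [X in _ + X = _]addrC addrACA addrA.
Qed.

Definition absorb : ideal (ideal_alg I) :=
  Ideal absorb0 absorbP absorbMl absorbMr.

(** In the jet case r(nw) = alpha(n) beta(w) and r(un) = alpha(u) beta(n) vanish for n in [N].
    Choosing u, w in I by [jet_ideal] gives alpha = beta = 0 on [N], so r kills aN and Na. *)
Lemma absorb_kernel :
  N `<=` @common_kernel F (ideal_alg I) ->
  absorb `<=` @common_kernel F (ideal_alg I).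
Proof.
move=> Nk x [n1 [n2 [n3 [N1 N2 N3 ->]]]] M rho Hrho.
have [rho' H rho'E] := simple_rep_extend F2 Hrho.
have rN n : (N : set _) n -> schur_rep H (val n) = 0.
  by move=> Nn; apply: val_inj; rewrite /= rho'E; apply: Nk Hrho.
rewrite -rho'E; suff : schur_rep H
    (val (n1 + ideal_lact a n2 + ideal_ract n3 a)) = 0 by move/(congr1 val).
have rD u v : schur_rep H (u + v) = schur_rep H u + schur_rep H v.
  exact: raddfD.
rewrite !val_idealE !rD (rN _ N1) add0r.
case: (schur_dichotomy H) => [[_ rM]|[z [beta [jetP [x1 alpha1] [y1 beta1]]]]].
  by rewrite !rM (rN _ N2) (rN _ N3) mulr0 mul0r addr0.
have [l rl0] := schur_rep_neq0 Hrho.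
have {}rl0 : schur_rep H (val l) != 0.
  by apply: contra_neq rl0 => /(congr1 val) rl0; apply: val_inj; rewrite /= -rho'E.
have [[u Iu alpha_u] [w Iw beta_w]] :=
  jet_ideal jetP (ideal_valP l) rl0 alpha1 beta1.
have [[_ alphaM] _ rM] := jetP.
have alphaN n : (N : set _) n -> defect H z (val n) = 0.
  move=> Nn; have := rN _ (Defs.idealMr (in_ideal Iw) Nn).
  rewrite val_nmul rM (rN _ Nn) mul0r add0r => /eqP.
  by rewrite mulf_eq0 (negPf (beta_w : beta (val (in_ideal Iw)) != 0)) orbF => /eqP.
have betaN n : (N : set _) n -> beta (val n) = 0.
  move=> Nn; have := rN _ (Defs.idealMl (in_ideal Iu) Nn).
  rewrite val_nmul rM (rN _ Nn) mulr0 add0r => /eqP; rewrite mulf_eq0.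
  by rewrite (negPf (alpha_u : defect H z (val (in_ideal Iu)) != 0)) => /eqP.
rewrite !rM (rN _ N2) (rN _ N3) (alphaN _ N3) (betaN _ N2).
by rewrite !(mulr0, mul0r, addr0).
Qed.

End Absorb.

Local Notation N := (kernel_core_ideal (ideal_alg I)).

Lemma kernel_core_lact a n : (N : set _) n -> (N : set _) (ideal_lact a n).
Proof.
move=> Nn; exists (absorb N a); last first.
  exists 0, n, 0; split=> //; try exact: ideal0.
  by apply: val_inj; rewrite !val_idealE nmul0l add0r addr0.
by apply: absorb_kernel => b [L Lk /Lk].
Qed.

Lemma kernel_core_ract a n : (N : set _) n -> (N : set _) (ideal_ract n a).
Proof.
move=> Nn; exists (absorb N a); last first.
  exists 0, 0, n; split=> //; try exact: ideal0.
  by apply: val_inj; rewrite !val_idealE nmulr0 !add0r.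
by apply: absorb_kernel => b [L Lk /Lk].
Qed.

(** A representation killing I kills [x]; any other restricts to an irreducible one of I. *)
Lemma common_kernel_val x :
  common_kernel x -> common_kernel (val (x : ideal_alg I)).
Proof.
move=> xk M rho H.
have [rhoI|rhoI] := pselect (exists2 l, (I : set A) l & rho l != 0).
  exact: xk (simple_rep_restrict H rhoI).
apply/eqP/negPn/negP => rho_x; apply: rhoI.
by exists (val x); first exact: ideal_valP.
Qed.

Lemma image_kernel_core0 : (val @` (N : set (ideal_alg I))) 0.
Proof. by exists 0; [apply: ideal0|apply: raddf0]. Qed.
Lemma image_kernel_coreP c x y : (val @` (N : set (ideal_alg I))) x ->
  (val @` (N : set (ideal_alg I))) y -> (val @` (N : set (ideal_alg I))) (c *: x + y).
Proof.
move=> [m Nm <-] [n Nn <-]; exists (c *: m + n); first exact: idealP.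
by rewrite linearP.
Qed.
Lemma image_kernel_coreMl x y : (val @` (N : set (ideal_alg I))) y ->
  (val @` (N : set (ideal_alg I))) (nmul x y).
Proof.
by move=> [n Nn <-]; exists (ideal_lact x n); first exact: kernel_core_lact.
Qed.
Lemma image_kernel_coreMr x y : (val @` (N : set (ideal_alg I))) x ->
  (val @` (N : set (ideal_alg I))) (nmul x y).
Proof.
by move=> [n Nn <-]; exists (ideal_ract n y); first exact: kernel_core_ract.
Qed.

Lemma kernel_core_hereditary :
  val @` @kernel_core F (ideal_alg I) = @kernel_core F A `&` I.
Proof.
apply/seteqP; split=> [_ [x xN <-]|a [[L Lk La] Ia]].
  split; last exact: ideal_valP.
  exists (Ideal image_kernel_core0 image_kernel_coreP
    image_kernel_coreMl image_kernel_coreMr); last by exists x.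
  by move=> _ [y [J Jk Jy] <-]; apply: common_kernel_val; apply: Jk.
exists (in_ideal Ia) => //.
pose J : set (ideal_alg I) := [set x | (L : set A) (val x)].
have J0 : J 0 by rewrite /J /mkset val_ideal0; apply: ideal0.
have JP c x y : J x -> J y -> J (c *: x + y).
  by rewrite /J /mkset val_idealD val_idealZ; apply: idealP.
have JMl x y : J y -> J (nmul x y) by apply: Defs.idealMl.
have JMr x y : J x -> J (nmul x y) by apply: Defs.idealMr.
exists (Ideal J0 JP JMl JMr) => // x Lx M rho H.
have [rho' H' <-] := simple_rep_extend F2 H.
exact: Lk Lx _ _ H'.
Qed.

End Heredity.

Unset Implicit Arguments.

Theorem theorem5p8 (F : fieldType) (hF : 2%N \notin [pchar F])
    (A : novikovType F) (I : ideal A) :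
  val @` jacobson (ideal_alg I) = jacobson A `&` I.
Proof. by rewrite !jacobsonE //; apply: kernel_core_hereditary. Qed.
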